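(* Let $X$ be a topological space. The notions of complete inverse semigroup over $X$ and of étale groupoid with unit space $X$ are equivalent up to isomorphisms. That is, the assignments $G\mapsto(\mathcal I(G),\rho_G)$ and $(S,\rho)\mapsto\mathrm{Germs}(S,\rho)$ are mutually inverse up to isomorphism: $\mathrm{Germs}(\mathcal I(G),\rho_G)\cong G$ for every étale groupoid $G$ with unit space $X$, and $(\mathcal I(H),\rho_H)\cong(S,\rho)$, where $H=\mathrm{Germs}(S,\rho)$, for every complete inverse semigroup $(S,\rho)$ over $X$.
   Context: An inverse semigroup is a semigroup in which every element $s$ has a unique inverse $s^*$ ($ss^*s=s$, $s^*ss^*=s^*$); $E(S)$ is its set of idempotents. Natural order: $s\le t$ iff $s=ft$ for some $f\in E(S)$. Elements $s,t$ are compatible if $st^*$ and $s^*t$ are idempotents; a subset is compatible if any two of its elements are. $S$ is complete if every compatible subset has a join in the natural order (so $S$ is a monoid, with unit $e$). For a topological space $X$, $\mathcal I(X)$ is the inverse semigroup of all homeomorphisms between open subsets of $X$, with product $hh'$ defined on $h^{-1}(\mathrm{cod}(h)\cap\mathrm{dom}(h'))$ by $(hh')(x)=h'(h(x))$ (first $h$, then $h'$). A representation $\rho:S\to\mathcal I(X)$ is a semigroup homomorphism; it is full if it restricts to an isomorphism $E(S)\to E(\mathcal I(X))\cong\Omega(X)$ (the topology of $X$). A complete inverse semigroup over $X$ is a pair $(S,\rho)$ with $S$ a complete inverse semigroup and $\rho$ a full representation on $X$. Isomorphisms $(S,\rho)\cong(S',\rho')$ are semigroup isomorphisms $\varphi$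 with $\rho'\circ\varphi=\rho$; isomorphisms of étale groupoids with unit space $X$ are isomorphisms of topological groupoids that are the identity on $X$. A topological groupoid $G$ has spaces $G_1$ (arrows), $G_0$ (objects, or units) and continuous maps $d,r:G_1\to G_0$, $u:G_0\to G_1$, $i:G_1\to G_1$, and multiplication $xy$ defined when $r(x)=d(y)$, satisfying the usual groupoid axioms; it is étale if $d$ is a local homeomorphism. A local bisection is identified with an open set $V\subset G_1$ on which $d$ and $r$ are injective. $\mathcal I(G)$ is the inverse semigroup of local bisections under pointwise multiplication and inverse, and $\rho_G:\mathcal I(G)\to\mathcal I(G_0)$ sends $V$ to the homeomorphism $d(V)\to r(V)$, $d(x)\mapsto r(x)$ ($x\in V$). Germs: for $(S,\rho)$ with $\rho$ full, $s\in S$, $x\in\mathrm{dom}(\rho(s))$: $\mathrm{germ}_x s=\{t\in S\mid\exists f\in E(S): ft=fs,\ x\in\mathrm{dom}(\rho(t))\cap\mathrm{dom}(\rho(f))\}$, $\mathrm{Germs}(S,\rho)=\{(x,\mathrm{germ}_x s)\mid s\in S,\ x\in\mathrm{dom}(\rho(s))\}$ with basis of open sets $U_s=\{(x,\mathrm{germ}_x s)\mid x\in\mathrm{dom}(\rho(s))\}$; it is an étale groupoid with object space $X$ under $d(x,\mathrm{germ}_x s)=x$, $r(x,\mathrm{germ}_x s)=\rho(s)(x)$, $1_x=(x,\mathrm{germ}_x e)$, $(x,\mathrm{germ}_x s)(\rho(s)(x),\mathrm{germ}_{\rho(s)(x)}t)=(x,\mathrm{germ}_x(st))$, $(x,\mathrm{germ}_x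 s)^{-1}=(\rho(s)(x),\mathrm{germ}_{\rho(s)(x)}s^* )$. *)

(* Defs.v *)
From HB Require Import structures.
From mathcomp Require Import all_boot all_classical topology.

Set Implicit Arguments.
Unset Strict Implicit.
Unset Printing Implicit Defensive.

Local Open Scope classical_set_scope.
Local Open Scope group_scope.

Definition is_inverse (S : semigroupType) (s t : S) : Prop :=
  s * t * s = s /\ t * s * t = t.

HB.mixin Record Semigroup_isInverse S & Semigroup S := {
  ex1_inverse : forall s : S, exists! t : S, is_inverse s t
}.

#[short(type="inverseSemigroupType")]
HB.structure Definition InverseSemigroup :=
  {S of Semigroup_isInverse S & Semigroup S}.

Section InverseSemigroup.
Variable S : inverseSemigroupType.
Implicit Types (s t e f : S) (A : set S).

Definition star s : S := projT1 (cid (ex1_inverse s)).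

Definition idem : set S := [set e | e * e = e].

Definition nat_le s t : Prop := exists2 f, idem f & s = f * t.

Definition compatible s t : Prop := idem (s * star t) /\ idem (star s * t).

Definition compatible_set A : Prop :=
  forall s t, A s -> A t -> compatible s t.

Definition is_join A s : Prop :=
  (forall t, A t -> nat_le t s) /\
  (forall s', (forall t, A t -> nat_le t s') -> nat_le s s').

Definition complete : Prop :=
  forall A, compatible_set A -> exists s, is_join A s.

Lemma starP s : is_inverse s (star s).
Proof. by rewrite /star; case: cid => t []. Qed.

Lemma star_unique s t : is_inverse s t -> t = star s.
Proof.
by rewrite /star => st; case: cid => t' [_ h] /=; rewrite (h _ st).
Qed.

Lemma starKl s : s * star s * s = s. Proof. by case: (starP s). Qed.
Lemma starKr s : star s * s * star s = star s. Proof. by case: (starP s). Qed.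

Lemma starK s : star (star s) = s.
Proof. by apply/esym/star_unique; case: (starP s). Qed.

Lemma idem_star e : idem e -> star e = e.
Proof. by move=> ee; apply/esym/star_unique; rewrite /is_inverse !ee. Qed.

Lemma idem_mulss s : idem (s * star s).
Proof. by rewrite /idem /= mulgA starKl. Qed.

Lemma idem_starss s : idem (star s * s).
Proof. by rewrite /idem /= mulgA starKr. Qed.

Lemma idemM e f : idem e -> idem f -> idem (e * f).
Proof.
move=> ee ff; have [x1 x2] := starP (e * f).
move: (star_unique (s := e * f)) x1 x2; move: (star (e * f)) (starK (e * f)).
move=> x xK xU x1 x2.
have eK z : e * (e * z) = e * z by rewrite mulgA ee.
have fK z : f * (f * z) = f * z by rewrite mulgA ff.
have fxe : f * x * e = x.
  apply: xU; split; first by rewrite -[in RHS]x1 -!mulgA eK fK.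
  by rewrite -!mulgA eK fK -[in RHS]x2 -!mulgA.
have xx : idem x.
  have : f * x * e * (f * x * e) = f * x * e by rewrite -[in RHS]x2 !mulgA.
  by rewrite fxe.
by rewrite -xK idem_star.
Qed.

Lemma idemC e f : idem e -> idem f -> e * f = f * e.
Proof.
move=> ee ff; have efi := idemM ee ff; have fei := idemM ff ee.
have eK z : e * (e * z) = e * z by rewrite mulgA ee.
have fK z : f * (f * z) = f * z by rewrite mulgA ff.
rewrite -(idem_star efi); apply/esym/star_unique; split.
  by rewrite -[RHS]efi -!mulgA fK eK.
by rewrite -[RHS]fei -!mulgA fK eK.
Qed.

Lemma starM s t : star (s * t) = star t * star s.
Proof.
apply/esym/star_unique.
have h := idemC (idem_mulss t) (idem_starss s).
split.
  rewrite -!mulgA (mulgA t) (mulgA (star s)) (mulgA (t * _)) h.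
  by rewrite -!mulgA [t * _]mulgA starKl !mulgA starKl.
rewrite -!mulgA (mulgA (star s)) (mulgA t) (mulgA (star s * s)) -h.
by rewrite -!mulgA [star s * _]mulgA starKr !mulgA starKr.
Qed.

Lemma idem_conj s e : idem e -> idem (s * e * star s).
Proof.
move=> ee; rewrite /idem /= -!mulgA (mulgA (star s)) (mulgA e).
rewrite (idemC ee (idem_starss s)) -!mulgA (mulgA e) ee.
by rewrite (mulgA s) (mulgA (s * _)) starKl.
Qed.

Lemma idem_conjV s e : idem e -> idem (star s * e * s).
Proof. by move=> ee; rewrite -{2}(starK s); exact: idem_conj. Qed.

Lemma conj_pull s e : idem e -> s * e * star s * s = s * e.
Proof.
move=> ee; rewrite -!mulgA (idemC ee (idem_starss s)).
by rewrite !mulgA starKl.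
Qed.

Lemma nat_le_idem s e : idem e -> nat_le s e -> idem s.
Proof. by move=> ee [f ff ->]; exact: idemM. Qed.

Lemma complete_unit : complete -> exists e, forall s, e * s = s /\ s * e = s.
Proof.
move=> cS; have [|j [ub lub]] := cS idem.
  by move=> s t ss tt; split; rewrite idem_star//; exact: idemM.
have jj : idem j.
  apply: (nat_le_idem (idem_mulss j)); apply: lub => e ee.
  have [f ff eE] := ub _ ee; exists f => //.
  have -> : e = f * (j * star j * f).
    by rewrite -{1}(ee : e * e = e) -{2}(idem_star ee) eE starM (idem_star ff)
      !mulgA.
  by rewrite (idemC (idem_mulss j) ff) mulgA ff.
have jl e : idem e -> j * e = e.
  move=> ee; have [f ff ->] := ub _ ee.
  by rewrite (idemC ff jj) mulgA jj.
exists j => s; split.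
  by rewrite -{1}(starKl s) mulgA jl ?starKl//; exact: idem_mulss.
have h : star s * s * j = star s * s.
  by rewrite -(idemC jj (idem_starss s)) jl//; exact: idem_starss.
by rewrite -{1}(starKl s) -!mulgA (mulgA (star s)) h mulgA starKl.
Qed.

End InverseSemigroup.

(* A partial map from [A] to [B] is a function [A -> option B]. Taking
   [U := setT] below shows that its domain is open; for an open domain the rest
   of the condition is continuity for the subspace topology. *)
Definition pcontinuous (A B : topologicalType) (f : A -> option B) : Prop :=
  forall U, open U -> open [set x | exists2 y, f x = Some y & U y].

Definition pfun_of_rel (A B : Type) (R : A -> B -> Prop) (x : A) : option B :=
  if pselect (exists y, R x y) is left e then Some (projT1 (cid e)) else None.

Lemma pfun_of_relP (A B : Type) (R : A -> B -> Prop) (x : A) (y : B) :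
  (forall y', R x y -> R x y' -> y' = y) ->
  pfun_of_rel R x = Some y <-> R x y.
Proof.
rewrite /pfun_of_rel => Rfun; case: pselect => [e|ne]; last first.
  by split=> // Rxy; case: ne; exists y.
by case: cid => y' /= Rxy'; split=> [[<-]//|Rxy]; rewrite (Rfun y').
Qed.

Record phomeo (X : topologicalType) := PHomeo {
  phomeo_fun :> X -> option X;
  phomeo_inv : X -> option X;
  phomeoP : forall x y, phomeo_fun x = Some y <-> phomeo_inv y = Some x;
  phomeo_cont : pcontinuous phomeo_fun;
  phomeo_inv_cont : pcontinuous phomeo_inv
}.

HB.instance Definition _ (X : topologicalType) := gen_eqMixin (phomeo X).
HB.instance Definition _ (X : topologicalType) := gen_choiceMixin (phomeo X).

Section PHomeo.
Variable X : topologicalType.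
Implicit Types h k : phomeo X.

Definition pdom h : set X := [set x | exists y, h x = Some y].
Definition pcod h : set X := [set y | exists x, h x = Some y].

Lemma eq_option (A : Type) (o o' : option A) :
  (forall a, o = Some a <-> o' = Some a) -> o = o'.
Proof.
case: o o' => [a|] [b|]// H; first by apply/esym/H.
  by apply/esym/H.
by apply/H.
Qed.

Lemma phomeo_ext h k : (forall x y, h x = Some y <-> k x = Some y) -> h = k.
Proof.
case: h k => [f f' ff' cf cf'] [g g' gg' cg cg'] /= fg.
have ? : f = g by apply/funext => x; apply: eq_option => y; exact: fg.
have ? : f' = g'.
  by apply/funext => x; apply: eq_option => y; rewrite -ff' -gg'; exact: fg.
by subst; congr PHomeo; exact: Prop_irrelevance.
Qed.

Lemma phomeo_inj h x x' y : h x = Some y -> h x' = Some y -> x = x'.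
Proof. by move=> /phomeoP E /phomeoP; rewrite E => -[]. Qed.

(* Diagrammatic order: first [h], then [k]. *)
Lemma pmul_subproof h k x y :
  obind k (h x) = Some y <-> obind (phomeo_inv h) (phomeo_inv k y) = Some x.
Proof.
split.
  by case E: (h x) => [z|]//= /phomeoP ->/=; apply/phomeoP.
by case E: (phomeo_inv k y) => [z|]//= /phomeoP ->/=; apply/phomeoP.
Qed.

Lemma pcontinuous_comp (A B C : topologicalType)
    (f : A -> option B) (g : B -> option C) :
  pcontinuous f -> pcontinuous g -> pcontinuous (fun x => obind g (f x)).
Proof.
move=> cf cg U oU; have := cf _ (cg _ oU); congr open; apply/seteqP.
split=> [x [y fx [z gy Uz]]|x [z]] /=; first by exists z; rewrite // fx.
by case E: (f x) => [y|]//= gy Uz; exists y => //; exists z.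
Qed.

Definition pmul h k : phomeo X :=
  PHomeo (pmul_subproof h k)
    (pcontinuous_comp (@phomeo_cont _ h) (@phomeo_cont _ k))
    (pcontinuous_comp (@phomeo_inv_cont _ k) (@phomeo_inv_cont _ h)).

Lemma pmulE h k x y :
  pmul h k x = Some y <-> exists2 z, h x = Some z & k z = Some y.
Proof.
split=> [/=|[z /= -> /=]//]; by case E: (h x) => [z|]//= ?; exists z.
Qed.

Lemma pmulA : associative pmul.
Proof. by move=> h k l; apply: phomeo_ext => x y /=; case: (h x). Qed.

HB.instance Definition _ := isSemigroup.Build (phomeo X) pmulA.

Definition pinv h : phomeo X :=
  PHomeo (fun x y => iff_sym (@phomeoP _ h y x))
    (@phomeo_inv_cont _ h) (@phomeo_cont _ h).

Lemma pinvE h x y : pinv h x = Some y <-> h y = Some x.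
Proof. by split=> /phomeoP. Qed.

Lemma mulE h k x y :
  (h * k) x = Some y <-> exists2 z, h x = Some z & k z = Some y.
Proof. exact: pmulE. Qed.

Lemma is_inverse_pinv h : is_inverse h (pinv h).
Proof.
split; apply: phomeo_ext => x y; split.
- by move=> /mulE[z /mulE[w hx /pinvE hz] hy]; rewrite (phomeo_inj hx hz).
- move=> hx; apply/mulE; exists x => //; apply/mulE; exists y => //.
  exact/pinvE.
- move=> /mulE[z /mulE[w /pinvE hx hw] /pinvE hy]; apply/pinvE.
  by move: hw; rewrite hx hy.
- move=> /pinvE hx; apply/mulE; exists x; last exact/pinvE.
  by apply/mulE; exists y => //; apply/pinvE.
Qed.

Lemma phomeo_ex1_inverse h : exists! k, is_inverse h k.
Proof.
have inv1 h1 k1 : h1 * k1 * h1 = h1 ->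
    forall x y, h1 x = Some y -> k1 y = Some x.
  move=> E x y hx.
  have /mulE[z /mulE[w hw kz] hz] : (h1 * k1 * h1) x = Some y by rewrite E.
  move: hw; rewrite hx => -[wE]; move: kz; rewrite -wE => ->.
  by rewrite (phomeo_inj hz hx).
exists (pinv h); split=> [|k [k1 k2]]; first exact: is_inverse_pinv.
apply: phomeo_ext => x y; split=> [/pinvE/(inv1 _ _ k1)//|/(inv1 _ _ k2) ?].
exact/pinvE.
Qed.

HB.instance Definition _ :=
  Semigroup_isInverse.Build (phomeo X) phomeo_ex1_inverse.

Lemma star_pinv h : star h = pinv h.
Proof. exact/esym/star_unique/is_inverse_pinv. Qed.

Lemma starE h x y : star h x = Some y <-> h y = Some x.
Proof. by rewrite star_pinv; exact: pinvE. Qed.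

Lemma idemE h x y : idem h -> h x = Some y -> y = x.
Proof.
move=> hh hx; have := hx; rewrite -{1}hh => /mulE[z].
by rewrite hx => -[<-] /phomeo_inj; exact.
Qed.

Lemma open_pdom h : open (pdom h).
Proof.
have := @phomeo_cont _ h _ openT; congr open.
by apply/seteqP; split=> x [y]; exists y.
Qed.

Definition pidU (U : set X) : X -> option X :=
  fun x => if pselect (U x) then Some x else None.

Lemma pidUE U x y : pidU U x = Some y <-> U x /\ x = y.
Proof.
rewrite /pidU; case: pselect => Ux; split.
- by case.
- by case=> _ xy; congr Some.
- by [].
- by case.
Qed.

Lemma pidU_sym U x y : pidU U x = Some y <-> pidU U y = Some x.
Proof. by rewrite !pidUE; split=> -[Ux xy]; subst. Qed.

Lemma pidU_cont U : open U -> pcontinuous (pidU U).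
Proof.
move=> oU V oV; have := openI oU oV; congr open; apply/seteqP; split=> x /=.
  by move=> [Ux Vx]; exists x => //; apply/pidUE.
by move=> [y /pidUE[Ux <-] Vx].
Qed.

Definition pid (U : set X) (oU : open U) : phomeo X :=
  PHomeo (pidU_sym U) (pidU_cont oU) (pidU_cont oU).

Lemma pidE U (oU : open U) x y : pid oU x = Some y <-> U x /\ x = y.
Proof. exact: pidUE. Qed.

Lemma idem_pid U (oU : open U) : idem (pid oU).
Proof.
apply: phomeo_ext => x y; split.
  by move=> /mulE[z /pidE[Ux <-] /pidE[]] *; apply/pidE.
by move=> /pidE[Ux <-]; apply/mulE; exists x; apply/pidE.
Qed.

Lemma pdom_pid U (oU : open U) : pdom (pid oU) = U.
Proof.
apply/seteqP; split=> x; first by move=> [y /pidE[]].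
by move=> Ux; exists x; apply/pidE.
Qed.

Lemma idem_ext h k : idem h -> idem k -> pdom h = pdom k -> h = k.
Proof.
move=> hh kk hk; apply: phomeo_ext => x y; split=> E.
  have : pdom k x by rewrite -hk; exists y.
  by move=> [y' E']; rewrite E' (idemE hh E) (idemE kk E').
have : pdom h x by rewrite hk; exists y.
by move=> [y' E']; rewrite E' (idemE hh E') (idemE kk E).
Qed.
End PHomeo.

(* [rho] being multiplicative, a bijection between the sets of idempotents is an
   isomorphism of semigroups [E(S) -> E(I(X))]. *)
Definition full (X : topologicalType) (S : inverseSemigroupType)
    (rho : {multiplicative S -> phomeo X}) : Prop :=
  set_bij (@idem S) (@idem (phomeo X)) rho.

Record complete_inverse_semigroup_over (X : topologicalType) := {
  cis_sort :> inverseSemigroupType;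
  cis_complete : complete cis_sort;
  cis_rep : {multiplicative cis_sort -> phomeo X};
  cis_full : full cis_rep
}.

(* The inverse of a bijective multiplicative map is multiplicative. *)
Definition cis_iso (X : topologicalType)
    (S T : complete_inverse_semigroup_over X) : Prop :=
  exists phi : {multiplicative S -> T},
    bijective phi /\ forall s, cis_rep T (phi s) = cis_rep S s.

Record topological_groupoid (X : topologicalType) := {
  arrows :> topologicalType;
  gd : arrows -> X;
  gr : arrows -> X;
  gunit : X -> arrows;
  ginv : arrows -> arrows;
  gmul : forall g h : arrows, gr g = gd h -> arrows;
  gd_unit : forall x, gd (gunit x) = x;
  gr_unit : forall x, gr (gunit x) = x;
  gd_mul : forall g h (gh : gr g = gd h), gd (gmul gh) = gd g;
  gr_mul : forall g h (gh : gr g = gd h), gr (gmul gh) = gr h;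
  gmulA : forall g h k (gh : gr g = gd h) (hk : gr h = gd k)
    (gh_k : gr (gmul gh) = gd k) (g_hk : gr g = gd (gmul hk)),
    gmul gh_k = gmul g_hk;
  gmul_unitl : forall g x (xg : gr (gunit x) = gd g), gmul xg = g;
  gmul_unitr : forall g x (gx : gr g = gd (gunit x)), gmul gx = g;
  gd_inv : forall g, gd (ginv g) = gr g;
  gr_inv : forall g, gr (ginv g) = gd g;
  gmul_invl : forall g (gg : gr (ginv g) = gd g), gmul gg = gunit (gr g);
  gmul_invr : forall g (gg : gr g = gd (ginv g)), gmul gg = gunit (gd g);
  gd_cont : continuous gd;
  gr_cont : continuous gr;
  gunit_cont : continuous gunit;
  ginv_cont : continuous ginv;
  gmul_cont : continuous
    (fun p : [set gh : arrows * arrows | gr gh.1 = gd gh.2] =>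
       gmul (set_valP p))
}.

(* [f] restricts to a homeomorphism from [U] onto the open set [f(U)]: the last
   clause gives both that [f(U)] is open (for [V := U]) and that the inverse
   [f(U) -> U] is continuous. *)
Definition local_homeo (A B : topologicalType) (f : A -> B) : Prop :=
  forall a, exists U : set A,
    [/\ open U, U a, set_inj U f & {within U, continuous f}] /\
    forall V, open V -> V `<=` U -> open (f @` V).

Record etale_groupoid (X : topologicalType) := {
  etale_sort :> topological_groupoid X;
  gd_local_homeo : local_homeo (@gd X etale_sort)
}.

Definition groupoid_iso (X : topologicalType) (G H : topological_groupoid X) :
    Prop :=
  exists (phi : G -> H) (psi : H -> G),
    [/\ cancel phi psi, cancel psi phi, continuous phi & continuous psi] /\
    [/\ forall g, gd (phi g) = gd g,
        forall g, gr (phi g) = gr g,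
        forall x, phi (gunit G x) = gunit H x,
        forall g, phi (ginv g) = ginv (phi g) &
        forall g h (gh : gr g = gd h) (gh' : gr (phi g) = gd (phi h)),
          phi (gmul gh) = gmul gh'].

Section Groupoid.
Variables (X : topologicalType) (G : topological_groupoid X).
Implicit Types (g h k : G) (x : X) (V W : set G).

Lemma gmul_congr g g' h h' (gh : gr g = gd h) (gh' : gr g' = gd h') :
  g = g' -> h = h' -> gmul gh = gmul gh'.
Proof. by move=> ? ?; subst; congr gmul; exact: Prop_irrelevance. Qed.

Definition gcomp g h k : Prop := exists gh : gr g = gd h, gmul gh = k.

Lemma gcomp_d g h k : gcomp g h k -> gd k = gd g.
Proof. by move=> [gh <-]; exact: gd_mul. Qed.

Lemma gcomp_r g h k : gcomp g h k -> gr k = gr h.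
Proof. by move=> [gh <-]; exact: gr_mul. Qed.

Lemma gcomp_c g h k : gcomp g h k -> gr g = gd h.
Proof. by move=> []. Qed.

Lemma gcomp_fun g h k k' : gcomp g h k -> gcomp g h k' -> k = k'.
Proof. by move=> [a <-] [b <-]; exact: gmul_congr. Qed.

Lemma gcompA1 g h k gh ghk : gcomp g h gh -> gcomp gh k ghk ->
  exists2 hk, gcomp h k hk & gcomp g hk ghk.
Proof.
move=> [a <-] [b <-].
have c : gr h = gd k by rewrite -(gr_mul a).
have d : gr g = gd (gmul c) by rewrite gd_mul.
by exists (gmul c); [exists c|exists d; rewrite (gmulA b d)].
Qed.

Lemma gcompA2 g h k hk ghk : gcomp h k hk -> gcomp g hk ghk ->
  exists2 gh, gcomp g h gh & gcomp gh k ghk.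
Proof.
move=> [c <-] [d <-].
have a : gr g = gd h by rewrite d gd_mul.
have b : gr (gmul a) = gd k by rewrite gr_mul.
by exists (gmul a); [exists a|exists b; rewrite (gmulA b d)].
Qed.

Lemma gcomp_ul g x : gd g = x -> gcomp (gunit G x) g g.
Proof.
move=> <-; have a : gr (gunit G (gd g)) = gd g by rewrite gr_unit.
by exists a; exact: gmul_unitl.
Qed.

Lemma gcomp_ur g x : gr g = x -> gcomp g (gunit G x) g.
Proof.
move=> <-; have a : gr g = gd (gunit G (gr g)) by rewrite gd_unit.
by exists a; exact: gmul_unitr.
Qed.

Lemma gcomp_il g x : gr g = x -> gcomp (ginv g) g (gunit G x).
Proof.
by move=> <-; have a := gr_inv g; exists a; exact: gmul_invl.
Qed.

Lemma gcomp_ir g x : gd g = x -> gcomp g (ginv g) (gunit G x).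
Proof.
by move=> <-; have a := esym (gd_inv g); exists a; exact: gmul_invr.
Qed.

Lemma gcomp_Vl g h k : gcomp g h k -> gcomp (ginv g) k h.
Proof.
move=> ghk; have il := gcomp_il (gcomp_c ghk).
by have [h' /gcomp_fun E] := gcompA1 il (gcomp_ul (erefl _)); rewrite (E _ ghk).
Qed.

Lemma gcomp_Vr g h k : gcomp g h k -> gcomp k (ginv h) g.
Proof.
move=> ghk; have ir := gcomp_ir (esym (gcomp_c ghk)).
by have [h' /gcomp_fun E] := gcompA2 ir (gcomp_ur (erefl _)); rewrite (E _ ghk).
Qed.

Lemma gcomp_injl g h h' k : gcomp g h k -> gcomp g h' k -> h = h'.
Proof. by move=> /gcomp_Vl a /gcomp_Vl; exact: gcomp_fun. Qed.

Lemma gcomp_injr g g' h k : gcomp g h k -> gcomp g' h k -> g = g'.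
Proof. by move=> /gcomp_Vr a /gcomp_Vr; exact: gcomp_fun. Qed.

Lemma ginvK g : ginv (ginv g) = g.
Proof.
apply: gcomp_fun (gcomp_ur (erefl (gr (ginv (ginv g))))) _.
rewrite gr_inv gd_inv.
exact/gcomp_Vl/gcomp_il.
Qed.

Lemma ginv_unit x : ginv (gunit G x) = gunit G x.
Proof.
apply: gcomp_injl (gcomp_ir (erefl _)) _.
by rewrite gd_unit; apply: gcomp_ul; rewrite gd_unit.
Qed.

Lemma gcomp_inv g h k : gcomp g h k -> gcomp (ginv h) (ginv g) (ginv k).
Proof. by move=> /gcomp_Vl/gcomp_Vr/gcomp_Vl. Qed.

Lemma gcomp_idem g : gcomp g g g -> g = gunit G (gd g).
Proof. by move=> gg; apply: (gcomp_injl gg); apply: gcomp_ur; exact: gcomp_c gg. Qed.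

Lemma gmul_near g h k (N : set G) : gcomp g h k -> nbhs k N ->
  exists V W, [/\ open V, open W, V g, W h &
    forall g' h' k', V g' -> W h' -> gcomp g' h' k' -> N k'].
Proof.
move=> [gh <-] Nk.
pose Z := [set p : G * G | gr p.1 = gd p.2].
have ghZ : (g, h) \in Z by rewrite inE.
have := @gmul_cont X G (exist _ (g, h) ghZ) N.
have E : forall gh', gmul gh = @gmul X G g h gh' by move=> gh'; exact: gmul_congr.
rewrite /= -E => /(_ Nk).
move=> [O [/= [O' oO' <-] /= O'gh] sO].
move: oO'; rewrite openE => /(_ _ O'gh) [[P Q] /= [Pg Qh] PQ].
exists (interior P), (interior Q); split => //; try exact: open_interior.
move=> g' h' k' Pg' Qh' [gh' <-].
have gh'Z : (g', h') \in Z by rewrite inE.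
have : O' (g', h') by apply: PQ; split; apply: interior_subset.
move=> /(sO (exist _ (g', h') gh'Z)) /=.
by rewrite (gmul_congr _ gh' (erefl _) (erefl _)).
Qed.
End Groupoid.

Section Etale.
Variables (X : topologicalType) (G : etale_groupoid X).
Implicit Types (g h k : G) (x : X) (V W : set G).

Lemma gd_open V : open V -> open (@gd X G @` V).
Proof.
move=> oV; rewrite openE => _ [g Vg <-].
have [U [[oU Ug _ _] fU]] := @gd_local_homeo X G g.
have := fU _ (openI oU oV) (@subIsetl _ _ _); rewrite openE => /(_ (gd g)) h.
apply: filterS (h _); last by exists g.
by move=> _ [g' [_ ?] <-]; exists g'.
Qed.

Lemma open_invV V : open V -> open (@ginv X G @` V).
Proof.
move=> oV; have := (continuousP _).1 (@ginv_cont X G) _ oV; congr open.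
apply/seteqP; split=> [g Vg|_ [g Vg <-]] /=; last by rewrite ginvK.
by exists (ginv g) => //; rewrite ginvK.
Qed.

Lemma gr_open V : open V -> open (@gr X G @` V).
Proof.
move=> /open_invV/gd_open; congr open; apply/seteqP; split=> x.
  by move=> [_ [g Vg <-] <-]; exists g => //; rewrite gd_inv.
by move=> [g Vg <-]; exists (ginv g); [exists g|rewrite gd_inv].
Qed.

Lemma gunit_open (U : set X) : open U -> open (gunit G @` U).
Proof.
move=> oU; rewrite openE => _ [x Ux <-].
have [V [[oV Vx inj _] _]] := @gd_local_homeo X G (gunit G x).
have o1 := (continuousP _).1 (@gunit_cont X G) _ oV.
have o2 := (continuousP _).1 (@gd_cont X G) _ (openI oU o1).
rewrite /interior nbhsE; exists (V `&` @gd X G @^-1` (U `&` gunit G @^-1` V)).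
  by split; [exact: openI|split=> //=; rewrite gd_unit].
move=> g [Vg [Ug Vug]]; exists (gd g) => //.
by apply: inj; rewrite ?inE// gd_unit.
Qed.

Record bisection := Bisection {
  bis_set :> G -> Prop;
  bis_open : open bis_set;
  bis_gd_inj : set_inj bis_set (@gd X G);
  bis_gr_inj : set_inj bis_set (@gr X G)
}.

HB.instance Definition _ := gen_eqMixin bisection.
HB.instance Definition _ := gen_choiceMixin bisection.

Implicit Types (A B C : bisection).

Lemma bis_ext A B : (forall g, A g <-> B g) -> A = B.
Proof.
case: A B => [A a1 a2 a3] [B b1 b2 b3] /= AB.
have ? : A = B by apply/seteqP; split=> g /AB.
by subst; congr Bisection; exact: Prop_irrelevance.
Qed.

Lemma bis_dI A g h : A g -> A h -> gd g = gd h -> g = h.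
Proof. by move=> Ag Ah; apply: (@bis_gd_inj A) => //; exact: mem_set. Qed.

Lemma bis_rI A g h : A g -> A h -> gr g = gr h -> g = h.
Proof. by move=> Ag Ah; apply: (@bis_gr_inj A) => //; exact: mem_set. Qed.

Definition bis_mul_set (A B : set G) : set G :=
  [set k | exists g h (gh : gr g = gd h), [/\ A g, B h & gmul gh = k]].

Lemma bis_mul_setP (A B : set G) k :
  bis_mul_set A B k <-> exists g h, [/\ A g, B h & gcomp g h k].
Proof.
split=> [[g [h [gh [Ag Bh E]]]]|[g [h [Ag Bh [gh E]]]]].
  by exists g, h; split=> //; exists gh.
by exists g, h, gh.
Qed.

Lemma bis_section A g (N : set G) : A g -> nbhs g N ->
  nbhs (gd g) [set x | exists g', [/\ A g', N g' & gd g' = x]].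
Proof.
move=> Ag Ng; have oN : open (A `&` N°).
  by apply: openI; [exact: bis_open|exact: open_interior].
have := gd_open oN; rewrite openE => /(_ (gd g)) h.
apply: filterS (h _); last by exists g.
by move=> _ [g' [? /interior_subset ?] <-]; exists g'.
Qed.

Lemma bis_mul_open A B : open (bis_mul_set A B).
Proof.
rewrite openE => k /bis_mul_setP[g [h [Ag Bh ghk]]].
have BN : nbhs h B by apply: open_nbhs_nbhs; split=> //; exact: bis_open.
have [V [W [oV oW Vg Wk VW]]] := gmul_near (gcomp_Vl ghk) BN.
have oV' := (continuousP _).1 (@ginv_cont X G) _ oV.
have V'N : nbhs g (@ginv X G @^-1` V) by apply: open_nbhs_nbhs.
have := bis_section Ag V'N; rewrite -(gcomp_d ghk) => /gd_cont dN.
have WN : nbhs k W by apply: open_nbhs_nbhs.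
rewrite /interior; apply: filterS (filterI WN dN) => k' [Wk' [g' [Ag' Vg' dg']]].
have c : gr (ginv g') = gd k' by rewrite gr_inv.
have gc : gcomp (ginv g') k' (gmul c) by exists c.
apply/bis_mul_setP; exists g', (gmul c); split=> //.
  exact: VW gc.
by rewrite -{1}(ginvK g'); exact: gcomp_Vl gc.
Qed.

Lemma bis_mul_dI A B : set_inj (bis_mul_set A B) (@gd X G).
Proof.
move=> k k'; rewrite !inE => /bis_mul_setP[g [h [Ag Bh c]]].
move=> /bis_mul_setP[g' [h' [Ag' Bh' c']]].
rewrite (gcomp_d c) (gcomp_d c') => /(bis_dI Ag Ag') gE.
rewrite gE in c.
have hE := bis_dI Bh Bh' (etrans (esym (gcomp_c c)) (gcomp_c c')).
by rewrite hE in c; exact: gcomp_fun c c'.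
Qed.

Lemma bis_mul_rI A B : set_inj (bis_mul_set A B) (@gr X G).
Proof.
move=> k k'; rewrite !inE => /bis_mul_setP[g [h [Ag Bh c]]].
move=> /bis_mul_setP[g' [h' [Ag' Bh' c']]].
rewrite (gcomp_r c) (gcomp_r c') => /(bis_rI Bh Bh') hE.
rewrite hE in c.
have gE := bis_rI Ag Ag' (etrans (gcomp_c c) (esym (gcomp_c c'))).
by rewrite gE in c; exact: gcomp_fun c c'.
Qed.

Definition bis_mul A B : bisection :=
  Bisection (@bis_mul_open A B) (@bis_mul_dI A B) (@bis_mul_rI A B).

Lemma bis_mulE A B k :
  bis_mul A B k <-> exists g h, [/\ A g, B h & gcomp g h k].
Proof. exact: bis_mul_setP. Qed.

Lemma bis_mulA : associative bis_mul.
Proof.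
move=> A B C; apply: bis_ext => l; split.
  move=> /bis_mulE[g [hk [Ag /bis_mulE[h [k [Bh Ck c]]] c']]].
  have [gh ? ?] := gcompA2 c c'; apply/bis_mulE; exists gh, k; split=> //.
  by apply/bis_mulE; exists g, h.
move=> /bis_mulE[gh [k [/bis_mulE[g [h [Ag Bh c]]] Ck c']]].
have [hk ? ?] := gcompA1 c c'; apply/bis_mulE; exists g, hk; split=> //.
by apply/bis_mulE; exists h, k.
Qed.

HB.instance Definition _ := isSemigroup.Build bisection bis_mulA.

Lemma bisM A B k : (A * B)%g k <-> exists g h, [/\ A g, B h & gcomp g h k].
Proof. exact: bis_mulE. Qed.

Lemma bis_inv_dI A : set_inj (@ginv X G @` A) (@gd X G).
Proof.
move=> _ _ /set_mem[g Ag <-] /set_mem[h Ah <-].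
by rewrite !gd_inv => /(bis_rI Ag Ah) ->.
Qed.

Lemma bis_inv_rI A : set_inj (@ginv X G @` A) (@gr X G).
Proof.
move=> _ _ /set_mem[g Ag <-] /set_mem[h Ah <-].
by rewrite !gr_inv => /(bis_dI Ag Ah) ->.
Qed.

Definition bis_inv A : bisection :=
  Bisection (open_invV (@bis_open A)) (@bis_inv_dI A) (@bis_inv_rI A).

Lemma bis_invE A g : bis_inv A g <-> A (ginv g).
Proof.
split=> [[h Ah <-]|Ag]; first by rewrite ginvK.
by exists (ginv g) => //; exact: ginvK.
Qed.

Lemma bis_is_inverse A : is_inverse A (bis_inv A).
Proof.
have H B : B * bis_inv B * B = B.
  apply: bis_ext => k; split.
    move=> /bisM[l [h [/bisM[g [g' [Bg /bis_invE Bg' c]]] Bh c']]].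
    have E : g = ginv g' by apply: (bis_rI Bg Bg'); rewrite gr_inv (gcomp_c c).
    have := gcomp_d c'; rewrite (gcomp_d c) => kE.
    rewrite E in c; have := gcomp_fun c (gcomp_il (erefl _)) => lE.
    rewrite lE in c'.
    by rewrite (gcomp_fun c' (gcomp_ul _))//; have := gcomp_c c'; rewrite gr_unit.
  move=> Bk; apply/bisM; exists (gunit G (gd k)), k; split=> //.
    apply/bisM; exists k, (ginv k); split=> //; last exact: gcomp_ir.
    by apply/bis_invE; rewrite ginvK.
  exact: gcomp_ul.
split=> //; rewrite -{2}[A](_ : bis_inv (bis_inv A) = A)//.
by apply: bis_ext => g; rewrite !bis_invE ginvK.
Qed.

Lemma bis_ex1_inverse A : exists! B, is_inverse A B.
Proof.
have H B C : B * C * B = B -> forall g, B g -> C (ginv g).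
  move=> E g; rewrite -{1}E => Bg.
  have {}E : B * C * B = B := E.
  move: (Bg) => /bisM[l [b [/bisM[a [c [Ba Cc acl]] Bb lbg]]]].
  rewrite E in Bg.
  have aE : a = g.
    by apply: (bis_dI Ba Bg); rewrite (gcomp_d lbg) (gcomp_d acl).
  have bE : b = g by apply: (bis_rI Bb Bg); rewrite (gcomp_r lbg).
  subst; have lE := gcomp_injr lbg (gcomp_ul (erefl _)); subst.
  by rewrite -(gcomp_injl acl (gcomp_ir (erefl _))).
exists (bis_inv A); split=> [|B [h1 h2]]; first exact: bis_is_inverse.
apply: bis_ext => g; split=> [/bis_invE Ag|Bg].
  by rewrite -(ginvK g); exact: H h1 _ Ag.
by apply/bis_invE; exact: H h2 _ Bg.
Qed.

HB.instance Definition _ := Semigroup_isInverse.Build bisection bis_ex1_inverse.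

Lemma bis_star A : star A = bis_inv A.
Proof. exact/esym/star_unique/bis_is_inverse. Qed.

Lemma bis_starE A g : star A g <-> A (ginv g).
Proof. by rewrite bis_star; exact: bis_invE. Qed.

Lemma bis_idemE A g : idem A -> A g -> g = gunit G (gd g).
Proof.
move=> AA Ag; have : (A * A)%g g by rewrite AA.
move=> /bisM[a [b [Aa Ab c]]].
have aE : a = g by apply: (bis_dI Aa Ag); rewrite (gcomp_d c).
have bE : b = g by apply: (bis_rI Ab Ag); rewrite (gcomp_r c).
by subst; exact: gcomp_idem c.
Qed.

Lemma bis_idemP A : (forall g, A g -> g = gunit G (gd g)) -> idem A.
Proof.
move=> Au; apply: bis_ext => g; split.
  move=> /bisM[a [b [Aa Ab]]]; rewrite (Au _ Aa) => c.
  have dab := gcomp_c c; rewrite gr_unit in dab.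
  by rewrite (gcomp_fun c (gcomp_ul (esym dab))).
move=> Ag; apply/bisM; exists g, g; split=> //.
have {1}-> := Au _ Ag; exact: gcomp_ul.
Qed.

Lemma gunit_dI (U : set X) : set_inj (gunit G @` U) (@gd X G).
Proof. by move=> _ _ /set_mem[x _ <-] /set_mem[y _ <-]; rewrite !gd_unit => ->. Qed.

Lemma gunit_rI (U : set X) : set_inj (gunit G @` U) (@gr X G).
Proof. by move=> _ _ /set_mem[x _ <-] /set_mem[y _ <-]; rewrite !gr_unit => ->. Qed.

Definition bis_units (U : set X) (oU : open U) : bisection :=
  Bisection (gunit_open oU) (@gunit_dI U) (@gunit_rI U).

Lemma bis_units_idem U (oU : open U) : idem (bis_units oU).
Proof. by apply: bis_idemP => g [x _ <-]; rewrite gd_unit. Qed.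

Lemma bis_leE A B : nat_le A B <-> (A `<=` B).
Proof.
split=> [[E EE ->] g /bisM[e [b [Ee Bb c]]]|AB].
  rewrite (bis_idemE EE Ee) in c.
  have := gcomp_c c; rewrite gr_unit => dd.
  by rewrite (gcomp_fun c (gcomp_ul (esym dd))).
have oU := gd_open (@bis_open A).
exists (bis_units oU); first exact: bis_units_idem.
apply: bis_ext => g; split=> [Ag|].
  apply/bisM; exists (gunit G (gd g)), g; split; first by exists (gd g) => //; exists g.
    exact: AB.
  exact: gcomp_ul.
move=> /bisM[_ [b [[x [a Aa <-] <-] Bb c]]].
have := gcomp_c c; rewrite gr_unit => dd.
rewrite (gcomp_fun c (gcomp_ul (esym dd))).
by rewrite -(bis_dI (AB _ Aa) Bb dd).
Qed.

Lemma bis_complete : complete bisection.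
Proof.
move=> F cF; pose W : set G := \bigcup_(A in F) A.
have oW : open W by apply: bigcup_open => A _; exact: bis_open.
have dW : set_inj W (@gd X G).
  move=> g h /set_mem[A FA Ag] /set_mem[B FB Bh] dgh.
  have [_ iAB] := cF _ _ FA FB.
  have c : gr (ginv g) = gd h by rewrite gr_inv.
  have gc : gcomp (ginv g) h (gmul c) by exists c.
  have : (star A * B)%g (gmul c).
    by apply/bisM; exists (ginv g), h; split=> //; apply/bis_starE; rewrite ginvK.
  move=> /(bis_idemE iAB) E; rewrite E in gc.
  have := gcomp_Vl gc; rewrite ginvK => c2.
  by apply: (gcomp_fun (gcomp_ur _) c2); have := gcomp_c c2; rewrite gd_unit.
have rW : set_inj W (@gr X G).
  move=> g h /set_mem[A FA Ag] /set_mem[B FB Bh] rgh.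
  have [iAB _] := cF _ _ FA FB.
  have c : gr g = gd (ginv h) by rewrite gd_inv.
  have gc : gcomp g (ginv h) (gmul c) by exists c.
  have : (A * star B)%g (gmul c).
    by apply/bisM; exists g, (ginv h); split=> //; apply/bis_starE; rewrite ginvK.
  move=> /(bis_idemE iAB) E; rewrite E in gc.
  have := gcomp_Vr gc; rewrite ginvK => c2.
  apply: (gcomp_fun c2 (gcomp_ul _)).
  by have := gcomp_c c2; rewrite gr_unit.
exists (Bisection oW dW rW); split=> [A FA|B AB].
  by apply/bis_leE => g Ag; exists A.
by apply/bis_leE => g [A /AB/bis_leE]; exact.
Qed.

Definition bis_rel (V : set G) (x y : X) : Prop :=
  exists g, [/\ V g, gd g = x & gr g = y].

Lemma bis_funP A x y : pfun_of_rel (bis_rel A) x = Some y <-> bis_rel A x y.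
Proof.
apply: pfun_of_relP => y' [g [Ag gx <-]] [h [Ah hx <-]].
by rewrite (bis_dI Ag Ah)// gx.
Qed.

Lemma bis_fun_invP A x y :
  pfun_of_rel (bis_rel A) x = Some y <->
  pfun_of_rel (fun y x => bis_rel A x y) y = Some x.
Proof.
rewrite bis_funP pfun_of_relP// => x' [g [Ag <- gy]] [h [Ah <- hy]].
by rewrite (bis_rI Ag Ah)// gy.
Qed.

Lemma bis_fun_cont A : pcontinuous (pfun_of_rel (bis_rel A)).
Proof.
move=> U oU; have o1 := (continuousP _).1 (@gr_cont X G) _ oU.
have := gd_open (openI (@bis_open A) o1); congr open; apply/seteqP; split=> x.
  by move=> [g [Ag Ug] <-]; exists (gr g) => //; apply/bis_funP; exists g.
by move=> [y /bis_funP[g [Ag <- <-]] Uy]; exists g.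
Qed.

Lemma bis_inv_fun_cont A : pcontinuous (pfun_of_rel (fun y x => bis_rel A x y)).
Proof.
move=> U oU; have o1 := (continuousP _).1 (@gd_cont X G) _ oU.
have := gr_open (openI (@bis_open A) o1); congr open; apply/seteqP; split=> x.
  move=> [g [Ag Ug] <-]; exists (gd g) => //.
  by apply/bis_fun_invP/bis_funP; exists g.
by move=> [y /bis_fun_invP/bis_funP[g [Ag <- <-]] Uy]; exists g.
Qed.

Definition bis_rep A : phomeo X :=
  PHomeo (bis_fun_invP A) (@bis_fun_cont A) (@bis_inv_fun_cont A).

Lemma bis_repE A x y : bis_rep A x = Some y <-> bis_rel A x y.
Proof. exact: bis_funP. Qed.

Lemma bis_repM : {morph bis_rep : A B / A * B}.
Proof.
move=> A B; apply: phomeo_ext => x y; split.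
  move=> /bis_repE[k [/bisM[g [h [Ag Bh c]]] <- <-]]; apply/mulE.
  exists (gr g); apply/bis_repE; last by exists h; rewrite (gcomp_c c) (gcomp_r c).
  by exists g; rewrite (gcomp_d c).
move=> /mulE[z /bis_repE[g [Ag <- <-]] /bis_repE[h [Bh dh <-]]].
have c := esym dh; apply/bis_repE; exists (gmul c).
rewrite gd_mul gr_mul; split=> //; apply/bisM.
by exists g, h; split=> //; exists c.
Qed.

HB.instance Definition _ := isMultiplicative.Build bisection (phomeo X) bis_rep
  bis_repM.

Lemma bis_full : full bis_rep.
Proof.
split.
- by move=> A AA; rewrite /idem /= -gmulfM AA.
- move=> A B /set_mem AA /set_mem BB AB; apply: bis_ext => g.
  have H C D : idem C -> idem D -> bis_rep C = bis_rep D -> C g -> D g.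
    move=> CC DD CD Cg; have : bis_rep C (gd g) = Some (gr g).
      by apply/bis_repE; exists g.
    rewrite CD => /bis_repE[h [Dh dh rh]].
    by rewrite (bis_idemE CC Cg) -dh -(bis_idemE DD Dh).
  by split; exact: H.
- move=> h hh; exists (bis_units (open_pdom h)); first exact: bis_units_idem.
  apply: phomeo_ext => x y; split.
    move=> /bis_repE[g [[z [y' hz] <-]]]; rewrite gd_unit gr_unit => <- <-.
    by rewrite hz (idemE hh hz).
  move=> hx; apply/bis_repE; exists (gunit G x); rewrite gd_unit gr_unit.
  by split=> //; [exists x => //; exists y|rewrite (idemE hh hx)].
Qed.

Definition bisections : complete_inverse_semigroup_over X :=
  {| cis_sort := bisection; cis_complete := bis_complete;
     cis_rep := bis_rep; cis_full := bis_full |}.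
End Etale.

Section Germs.
Variables (X : topologicalType) (S : complete_inverse_semigroup_over X).
Local Notation rho := (cis_rep S).
Implicit Types (s t f : S) (x y : X).

Lemma rep_mulE s t x y :
  rho (s * t) x = Some y <-> exists2 z, rho s x = Some z & rho t z = Some y.
Proof. by rewrite gmulfM; exact: mulE. Qed.

Lemma rep_starE s x y : rho (star s) x = Some y <-> rho s y = Some x.
Proof.
have -> : rho (star s) = star (rho s); last exact: starE.
by apply: star_unique; rewrite /is_inverse -!gmulfM starKl starKr.
Qed.

Lemma rep_idem f : idem f -> idem (rho f).
Proof. by move=> ff; rewrite /idem /= -gmulfM ff. Qed.

Lemma rep_idemE f x y : idem f -> rho f x = Some y -> y = x.
Proof. by move=> ff; apply: idemE; exact: rep_idem. Qed.

Lemma rep_idem_fix f x : idem f -> pdom (rho f) x -> rho f x = Some x.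
Proof. by move=> ff [y E]; rewrite {1}E (rep_idemE ff E). Qed.

Lemma idem_of_open (U : set X) : open U -> exists2 f, idem f & pdom (rho f) = U.
Proof.
move=> oU; have [_ _ sur] := cis_full S.
have [f ff E] := sur _ (idem_pid oU).
by exists f => //; rewrite E pdom_pid.
Qed.

Lemma pdom_idemM f s x : idem f ->
  pdom (rho (f * s)) x <-> pdom (rho f) x /\ pdom (rho s) x.
Proof.
move=> ff; split=> [[y /rep_mulE[z fx sz]]|[fx [y sx]]].
  have zx := rep_idemE ff fx; rewrite zx in fx sz.
  by split; [exists x|exists y].
by exists y; apply/rep_mulE; exists x => //; exact: rep_idem_fix.
Qed.

Lemma pdom_star s x y : rho s x = Some y -> pdom (rho (star s)) y.
Proof. by move=> E; exists x; apply/rep_starE. Qed.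

Definition cis_unit : S := projT1 (cid (complete_unit (@cis_complete X S))).

Lemma cis_mul1 s : cis_unit * s = s.
Proof. by rewrite /cis_unit; case: cid => e h; case: (h s). Qed.

Lemma cis_mule s : s * cis_unit = s.
Proof. by rewrite /cis_unit; case: cid => e h; case: (h s). Qed.

Lemma pdom_unit x : pdom (rho cis_unit) x.
Proof.
have [f ff E] := idem_of_open openT.
have : pdom (rho f) x by rewrite E.
by move=> [y]; rewrite -(cis_mul1 f) => /rep_mulE[z ? _]; exists z.
Qed.

Definition germ x s : set S :=
  [set t | exists f, [/\ idem f, f * t = f * s, pdom (rho t) x
                       & pdom (rho f) x]].

(* The pairs [(x, germ x s)] with [x] in the domain of [rho s]. *)
Record germs := Germ {
  germ_pt : X;
  germ_set : set S;
  germP : exists2 s, pdom (rho s) germ_pt & germ_set = germ germ_pt s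
}.

HB.instance Definition _ := gen_eqMixin germs.
HB.instance Definition _ := gen_choiceMixin germs.

Definition mkgerm x s (sx : pdom (rho s) x) : germs :=
  Germ (ex_intro2 _ (fun A => germ x s = germ x A) s sx (erefl _)).

Definition germ_open (s : S) : set germs :=
  [set g | exists x (sx : pdom (rho s) x), g = mkgerm sx].

Implicit Types g h k : germs.

Lemma germs_ext g h : germ_pt g = germ_pt h -> germ_set g = germ_set h -> g = h.
Proof.
case: g h => [x A a] [y B b] /= xy AB; subst.
by congr Germ; exact: Prop_irrelevance.
Qed.

Lemma germ_openP s g : germ_open s g <->
  pdom (rho s) (germ_pt g) /\ germ_set g = germ (germ_pt g) s.
Proof.
split=> [[x [sx ->]]//|[sx gE]].
by exists (germ_pt g), sx; exact: germs_ext.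
Qed.

Lemma germ_open_mk x s (sx : pdom (rho s) x) : germ_open s (mkgerm sx).
Proof. by exists x, sx. Qed.

Lemma germ_open_pdom s g : germ_open s g -> pdom (rho s) (germ_pt g).
Proof. by move=> /germ_openP[]. Qed.

Lemma germ_open_ext s g h :
  germ_open s g -> germ_open s h -> germ_pt g = germ_pt h -> g = h.
Proof.
move=> /germ_openP[_ gE] /germ_openP[_ hE] gh; apply: germs_ext => //.
by rewrite gE hE gh.
Qed.

Definition germ_rep g : S := s2val (cid2 (germP g)).

Lemma germ_repP g : germ_open (germ_rep g) g.
Proof.
apply/germ_openP; split; first exact: s2valP (cid2 (germP g)).
exact: s2valP' (cid2 (germP g)).
Qed.

Lemma germ_eqP x s t : pdom (rho s) x -> pdom (rho t) x ->
  germ x s = germ x t <-> exists f, [/\ idem f, f * s = f * t & pdom (rho f) x].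
Proof.
move=> sx tx; split=> [E|[f [ff fst fx]]].
  have : germ x t s.
    rewrite -E; have [f ff fX] := idem_of_open openT.
    by exists f; split=> //; rewrite fX.
  by move=> [f [ff fst _ fx]]; exists f.
have kfx (k : S) : idem k -> pdom (rho k) x -> pdom (rho (k * f)) x.
  by move=> kk kx; apply/pdom_idemM.
apply/seteqP; split=> w [k [kk kw wx kx]].
  exists (k * f); split; [exact: idemM| |by []|exact: kfx].
  by rewrite {1}(idemC kk ff) -mulgA kw mulgA -(idemC kk ff) -mulgA fst mulgA.
exists (k * f); split; [exact: idemM| |by []|exact: kfx].
by rewrite {1}(idemC kk ff) -mulgA kw mulgA -(idemC kk ff) -mulgA -fst mulgA.
Qed.

Lemma germ_openU s t g : germ_open s g -> germ_open t g ->
  exists f, [/\ idem f, f * s = f * t & pdom (rho f) (germ_pt g)].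
Proof.
move=> /germ_openP[sx gs] /germ_openP[tx gt].
by apply/germ_eqP => //; rewrite -gs -gt.
Qed.

Lemma germ_open_eq s t f g : idem f -> f * s = f * t ->
  pdom (rho f) (germ_pt g) -> germ_open s g -> germ_open t g.
Proof.
move=> ff fst fx /germ_openP[sx gE].
have /(pdom_idemM _ _ ff)[_ tx] : pdom (rho (f * t)) (germ_pt g).
  by rewrite -fst; apply/pdom_idemM.
by apply/germ_openP; split=> //; rewrite gE; apply/germ_eqP => //; exists f.
Qed.

Lemma germ_open_restr f s g : idem f ->
  germ_open (f * s) g <-> pdom (rho f) (germ_pt g) /\ germ_open s g.
Proof.
move=> ff; have E : f * s = f * (f * s) by rewrite mulgA ff.
split=> [gs|[fx gs]]; last exact: germ_open_eq E fx gs.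
have [fx _] := (pdom_idemM s _ ff).1 (germ_open_pdom gs).
by split=> //; exact: germ_open_eq (esym E) fx gs.
Qed.

Lemma germ_open_cover :
  \bigcup_(U in [set germ_open s | s in setT]) U = setT.
Proof.
apply/seteqP; split=> // g _; exists (germ_open (germ_rep g)).
  by exists (germ_rep g).
exact: germ_repP.
Qed.

Lemma germ_open_join (U V : set germs) g :
  [set germ_open s | s in setT] U -> [set germ_open s | s in setT] V ->
  U g -> V g ->
  exists W, [/\ [set germ_open s | s in setT] W, W g & W `<=` U `&` V].
Proof.
move=> [s _ <-] [t _ <-] sg tg; have [f [ff fst fg]] := germ_openU sg tg.
exists (germ_open (f * s)); split; first by exists (f * s).
  exact/germ_open_restr.
move=> h hf; split; first by have /(germ_open_restr _ _ ff)[] := hf.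
by rewrite fst in hf; have /(germ_open_restr _ _ ff)[] := hf.
Qed.

HB.instance Definition _ :=
  isBaseTopological.Build germs germ_open_cover germ_open_join.

Lemma open_germ_open s : open (germ_open s).
Proof.
by exists [set germ_open s]; [move=> _ ->; exists s|rewrite bigcup_set1].
Qed.

Lemma open_germsP (A : set germs) :
  open A <-> forall g, A g -> exists2 s, germ_open s g & germ_open s `<=` A.
Proof.
split=> [[D' D'D <-] g [U D'U Ug]|H].
  have [s _ sU] := D'D _ D'U; exists s; rewrite sU//.
  by move=> h Uh; exists U.
rewrite openE => g /H[s sg sA]; rewrite /interior nbhsE.
by exists (germ_open s) => //; split=> //; exact: open_germ_open.
Qed.

Definition germ_d g : X := germ_pt g.

(* The operations are computed on a chosen representative [germ_rep g];
   [germ_rE], [germ_invE] and [germ_mulE] give their values on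
   [(x, germ x s)] for an arbitrary representative [s]. *)
Definition germ_r g : X := projT1 (cid (germ_open_pdom (germ_repP g))).

Lemma germ_rP s g : germ_open s g -> rho s (germ_d g) = Some (germ_r g).
Proof.
move=> sg; rewrite /germ_r; case: cid => y /= ry.
have [f [ff fst fg]] := germ_openU sg (germ_repP g).
have fx := rep_idem_fix ff fg.
have : rho (f * germ_rep g) (germ_pt g) = Some y.
  by apply/rep_mulE; exists (germ_pt g).
by rewrite -fst => /rep_mulE[z]; rewrite fx => -[<-].
Qed.

Definition germ_unit x : germs := mkgerm (pdom_unit x).

Lemma germ_inv_subproof g : pdom (rho (star (germ_rep g))) (germ_r g).
Proof. exact: pdom_star (germ_rP (germ_repP g)). Qed.

Definition germ_inv g : germs := mkgerm (germ_inv_subproof g).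

Lemma germ_invP s g : germ_open s g -> germ_open (star s) (germ_inv g).
Proof.
move=> sg; have tg := germ_repP g.
have [f [ff fst fg]] := germ_openU sg tg.
have fst' : star s * f = star (germ_rep g) * f.
  by rewrite -(idem_star ff) -!starM fst.
have H (a : S) : star a * f * a * star a = star a * f.
  by rewrite -!mulgA (idemC ff (idem_mulss a)) !mulgA starKr.
apply: (germ_open_eq (idem_conjV (germ_rep g) ff) _ _ (germ_open_mk _)).
  rewrite H -fst'.
  have -> : star s * f * germ_rep g = star s * f * s.
    by rewrite -!mulgA fst.
  by rewrite H.
exists (germ_r g); apply/rep_mulE; exists (germ_d g); last exact: germ_rP tg.
apply/rep_mulE; exists (germ_d g); last exact: rep_idem_fix.
exact/rep_starE/germ_rP.
Qed.

Lemma germ_mul_subproof g h (gh : germ_r g = germ_d h) :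
  pdom (rho (germ_rep g * germ_rep h)) (germ_d g).
Proof.
exists (germ_r h); apply/rep_mulE; exists (germ_r g).
  exact: germ_rP (germ_repP g).
by rewrite gh; exact: germ_rP (germ_repP h).
Qed.

Definition germ_mul g h (gh : germ_r g = germ_d h) : germs :=
  mkgerm (germ_mul_subproof gh).

Lemma germ_mulP s t g h (gh : germ_r g = germ_d h) :
  germ_open s g -> germ_open t h -> germ_open (s * t) (germ_mul gh).
Proof.
move=> sg th; have ag := germ_repP g; have bh := germ_repP h.
have [f [ff fst fg]] := germ_openU ag sg.
have [k [kk kst kh]] := germ_openU bh th.
have ck := idem_conj (germ_rep g) kk.
have cK c : germ_rep g * k * star (germ_rep g) * (germ_rep g * c)
            = germ_rep g * (k * c).
  by rewrite mulgA (conj_pull _ kk) mulgA.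
apply: (germ_open_eq (idemM ff ck) _ _ (germ_open_mk _)).
  rewrite -(mulgA f) cK kst -cK (mulgA f) (idemC ff ck).
  set c := (_ * k * _).
  by rewrite -(mulgA c) (mulgA f) fst -(mulgA f) (mulgA c).
apply/pdom_idemM => //; split=> //.
exists (germ_d g); apply/rep_mulE; exists (germ_r g); last first.
  exact/rep_starE/germ_rP.
apply/rep_mulE; exists (germ_r g); first exact: germ_rP.
by rewrite gh; exact: rep_idem_fix.
Qed.

Lemma germ_dE x s (sx : pdom (rho s) x) : germ_d (mkgerm sx) = x.
Proof. by []. Qed.

Lemma germ_rE x y s (sx : pdom (rho s) x) :
  rho s x = Some y -> germ_r (mkgerm sx) = y.
Proof.
by have := germ_rP (germ_open_mk sx); rewrite germ_dE => -> [].
Qed.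

Lemma germ_unitP x : germ_open cis_unit (germ_unit x).
Proof. exact: germ_open_mk. Qed.

Lemma germ_invE x y s (sx : pdom (rho s) x) (sy : pdom (rho (star s)) y) :
  rho s x = Some y -> germ_inv (mkgerm sx) = mkgerm sy.
Proof.
move=> E; apply: germ_open_ext (germ_invP (germ_open_mk sx)) (germ_open_mk _) _.
exact: germ_rE.
Qed.

Lemma germ_mulE x y s t (sx : pdom (rho s) x) (ty : pdom (rho t) y)
    (stx : pdom (rho (s * t)) x)
    (gh : germ_r (mkgerm sx) = germ_d (mkgerm ty)) :
  germ_mul gh = mkgerm stx.
Proof.
by apply: germ_open_ext (germ_mulP _ _ _) (germ_open_mk _) _ => //;
  exact: germ_open_mk.
Qed.

Lemma germ_idem f g : idem f -> germ_open f g -> g = germ_unit (germ_d g).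
Proof.
move=> ff fg; apply: (germ_open_ext fg) => //.
apply: (germ_open_eq ff _ _ (germ_unitP _)); first by rewrite ff cis_mule.
exact: germ_open_pdom fg.
Qed.

Lemma germ_r_unit x : germ_r (germ_unit x) = x.
Proof.
by apply: germ_rE; apply: rep_idem_fix (pdom_unit x); exact: cis_mul1.
Qed.

Lemma germ_r_mul g h (gh : germ_r g = germ_d h) : germ_r (germ_mul gh) = germ_r h.
Proof.
apply: germ_rE; apply/rep_mulE; exists (germ_r g).
  exact: germ_rP (germ_repP g).
by rewrite gh; exact: germ_rP (germ_repP h).
Qed.

Lemma germ_r_inv g : germ_r (germ_inv g) = germ_d g.
Proof. by apply/germ_rE/rep_starE; exact: germ_rP (germ_repP g). Qed.

Lemma germ_mulA g h k (gh : germ_r g = germ_d h) (hk : germ_r h = germ_d k)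
  (gh_k : germ_r (germ_mul gh) = germ_d k)
  (g_hk : germ_r g = germ_d (germ_mul hk)) : germ_mul gh_k = germ_mul g_hk.
Proof.
have [a b c] := And3 (germ_repP g) (germ_repP h) (germ_repP k).
apply: germ_open_ext (germ_mulP _ (germ_mulP _ a b) c) _ _ => //.
by rewrite -mulgA; exact: germ_mulP (germ_mulP _ b c).
Qed.

Lemma germ_mul_unitl g x (xg : germ_r (germ_unit x) = germ_d g) :
  germ_mul xg = g.
Proof.
have a := germ_repP g.
apply: germ_open_ext (germ_mulP _ (germ_unitP x) a) _ _.
  by rewrite cis_mul1.
by rewrite -[RHS]xg germ_r_unit.
Qed.

Lemma germ_mul_unitr g x (gx : germ_r g = germ_d (germ_unit x)) :
  germ_mul gx = g.
Proof.
have a := germ_repP g.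
apply: germ_open_ext (germ_mulP _ a (germ_unitP x)) _ _ => //.
by rewrite cis_mule.
Qed.

Lemma germ_mul_invl g (gg : germ_r (germ_inv g) = germ_d g) :
  germ_mul gg = germ_unit (germ_r g).
Proof.
have a := germ_repP g.
exact: germ_idem (idem_starss _) (germ_mulP gg (germ_invP a) a).
Qed.

Lemma germ_mul_invr g (gg : germ_r g = germ_d (germ_inv g)) :
  germ_mul gg = germ_unit (germ_d g).
Proof.
have a := germ_repP g.
exact: germ_idem (idem_mulss _) (germ_mulP gg a (germ_invP a)).
Qed.

Lemma germ_d_cont : continuous germ_d.
Proof.
apply/continuousP => U oU; apply/open_germsP => g Ug.
have [f ff fU] := idem_of_open oU; have a := germ_repP g.
exists (f * germ_rep g); first by apply/germ_open_restr => //; rewrite fU.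
by move=> h /(germ_open_restr _ _ ff)[]; rewrite fU.
Qed.

Lemma germ_r_cont : continuous germ_r.
Proof.
apply/continuousP => U oU; apply/open_germsP => g Ug; have a := germ_repP g.
have [f ff fU] := idem_of_open (@phomeo_cont _ (rho (germ_rep g)) _ oU).
exists (f * germ_rep g).
  apply/germ_open_restr => //; rewrite fU; split=> //.
  by exists (germ_r g) => //; exact: germ_rP.
move=> h /(germ_open_restr _ _ ff)[]; rewrite fU => -[y hy Uy] /germ_rP.
by rewrite /germ_d hy /= => -[<-].
Qed.

Lemma germ_unit_cont : continuous germ_unit.
Proof.
apply/continuousP => A /open_germsP H; rewrite openE => x /H[s sx sA].
have [f [ff fst fx]] := germ_openU (germ_unitP x) sx.
rewrite /interior nbhsE; exists (pdom (rho f)).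
  by split=> //; exact: open_pdom.
by move=> y fy; apply: sA; exact: (germ_open_eq (g := germ_unit y) ff fst fy (germ_unitP y)).
Qed.

Lemma germ_invK g : germ_inv (germ_inv g) = g.
Proof.
have a := germ_repP g.
apply: germ_open_ext (germ_invP (germ_invP a)) _ _; first by rewrite starK.
exact: germ_r_inv.
Qed.

Lemma germ_inv_cont : continuous germ_inv.
Proof.
apply/continuousP => A /open_germsP H; apply/open_germsP => g /H[s sg sA].
exists (star s); first by rewrite -(germ_invK g); exact: germ_invP.
by move=> h /germ_invP; rewrite starK => /sA.
Qed.

Lemma germ_mul_cont : continuous
  (fun p : [set gh : germs * germs | germ_r gh.1 = germ_d gh.2] =>
     germ_mul (set_valP p)).
Proof.
apply/continuousP => A /open_germsP H; rewrite openE => p /H[w wp wA].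
have a := germ_repP (set_val p).1; have b := germ_repP (set_val p).2.
have [f [ff fst fp]] := germ_openU (germ_mulP (set_valP p) a b) wp.
set s := germ_rep _ in a fst; set t := germ_rep _ in b fst.
pose O : set (germs * germs) := germ_open (f * s) `*` germ_open t.
have oO : open O.
  rewrite openE => -[g h] /= [Og Oh].
  exists (germ_open (f * s), germ_open t) => //=.
  by split; apply: open_nbhs_nbhs; split=> //; exact: open_germ_open.
exists (set_val @^-1` O); split.
- by exists O.
- by split=> //; apply/germ_open_restr.
- move=> q [/= q1 q2]; apply: wA.
  have := germ_mulP (set_valP q) q1 q2.
  by rewrite -mulgA fst => /(germ_open_restr _ _ ff)[].
Qed.

Lemma germ_d_local_homeo : local_homeo germ_d.
Proof.
move=> g; exists (germ_open (germ_rep g)); split.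
  split.
  - exact: open_germ_open.
  - exact: germ_repP.
  - by move=> h k /set_mem hs /set_mem; exact: germ_open_ext.
  - exact/continuous_subspaceT/germ_d_cont.
move=> V /open_germsP H _; rewrite openE => _ [h /H[s hs sV] <-].
rewrite /interior nbhsE; exists (pdom (rho s)).
  by split; [exact: open_pdom|exact: germ_open_pdom].
by move=> x sx; exists (mkgerm sx) => //; apply: sV; exact: germ_open_mk.
Qed.

Definition germ_groupoid : topological_groupoid X := {|
  arrows := germs; gd := germ_d; gr := germ_r; gunit := germ_unit;
  ginv := germ_inv; gmul := germ_mul;
  gd_unit := fun=> erefl; gr_unit := germ_r_unit;
  gd_mul := fun _ _ _ => erefl; gr_mul := germ_r_mul;
  gmulA := germ_mulA;
  gmul_unitl := germ_mul_unitl; gmul_unitr := germ_mul_unitr;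
  gd_inv := fun=> erefl; gr_inv := germ_r_inv;
  gmul_invl := germ_mul_invl; gmul_invr := germ_mul_invr;
  gd_cont := germ_d_cont; gr_cont := germ_r_cont;
  gunit_cont := germ_unit_cont; ginv_cont := germ_inv_cont;
  gmul_cont := germ_mul_cont |}.

Definition Germs : etale_groupoid X :=
  {| etale_sort := germ_groupoid; gd_local_homeo := germ_d_local_homeo |}.
End Germs.

(* Main.v *)
Require Import Defs.
From HB Require Import structures.
From mathcomp Require Import all_boot all_classical topology.

(** Both isomorphisms rest on the same matching: the basic open sets of a
groupoid of germs are bisections, and they correspond to the elements of the
inverse semigroup.

For an étale groupoid [G], the germ at [x] of a bisection [A] is determined by
the arrow of [A] with domain [x], because two bisections through a common arrow
[g] agree on their intersection, which is again a bisection. Evaluating a germ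
at its base point, [germ_eval], is therefore injective; it is surjective because
[G] is étale, which puts every arrow in some bisection ([bisection_at]). Both
maps are continuous by the single equivalence [germ_evalP]: the basic open set
of [A] is the preimage of [A] under [germ_eval]. The groupoid operations then
agree because products and inverses of germs are computed in the semigroup of
bisections, and a bisection has only one arrow over a given point.

For a complete inverse semigroup [S] over [X], send [s] to the bisection
[germ_bis s] of all germs of [s]. This is multiplicative and commutes with the
representations. It reflects the order ([germ_open_sub_le]): if every germ of
[s] is a germ of [t], then [s] and [t] agree after restriction to each of a
family of idempotents whose domains cover that of [s]. Since the idempotents of
[S] form the topology of [X], the corresponding restrictions of [s * star s]
have join [s * star s], and this forces [s] to lie below [t]. It is surjective
([germ_bis_surj]): a bisection [V] is the union of the [germ_bis s] that it
contains, those [s] are pairwise compatible, and [V] is the image of their join.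
The last point needs the germs of a join to be germs of the joined elements,
which holds because the domain of a join is the union of the domains
([pdom_join]). *)

Set Implicit Arguments.
Unset Strict Implicit.
Unset Printing Implicit Defensive.

Local Open Scope classical_set_scope.
Local Open Scope group_scope.

(** * The natural order of an inverse semigroup *)

Section NaturalOrder.
Variable S : inverseSemigroupType.
Implicit Types s t v e : S.

Lemma nat_leE s t : nat_le s t -> s * star s * t = s.
Proof.
move=> [f ff ->]; rewrite starM (idem_star ff).
have -> : f * t * (star t * f) * t = f * (t * star t * f) * t by rewrite !mulgA.
rewrite (idemC (idem_mulss t) ff) !mulgA ff.
by rewrite -!mulgA (mulgA t) starKl.
Qed.

Lemma nat_le_mulr s e : idem e -> nat_le (s * e) s.
Proof.
by move=> ee; exists (s * e * star s); [exact: idem_conj|rewrite conj_pull].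
Qed.

Lemma nat_le_anti s t : nat_le s t -> nat_le t s -> s = t.
Proof.
move=> [f ff sE] [k kk tE].
have fs : f * s = s by rewrite sE mulgA ff.
by rewrite {1}sE tE mulgA (idemC ff kk) -mulgA fs.
Qed.

Lemma nat_le_compatible s t v : nat_le s v -> nat_le t v -> compatible s t.
Proof.
move=> [f ff ->] [k kk ->]; rewrite /compatible !starM (idem_star ff) (idem_star kk).
split.
  have -> : f * v * (star v * k) = f * (v * star v) * k by rewrite !mulgA.
  by apply: idemM => //; apply: idemM => //; exact: idem_mulss.
have -> : star v * f * (k * v) = star v * (f * k) * v by rewrite !mulgA.
by apply: idem_conjV; exact: idemM.
Qed.

(** A join of idempotents [e] below [s] is idempotent, since each such [e] lies
below the idempotent [s * star s] as well. *)
Lemma idem_join (A : set S) s : A `<=` @idem S -> is_join A s -> idem s.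
Proof.
move=> Ai [ub lub]; apply: (nat_le_idem (idem_mulss s)).
apply: lub => e Ae; have ee := Ai _ Ae; exists e => //.
have es : e * s = e by rewrite -{2}(nat_leE (ub _ Ae)) (idem_star ee) ee.
have E : e * s * star (e * s) = e by rewrite es (idem_star ee).
rewrite -{1}E starM (idem_star ee) mulgA -(mulgA e s).
by rewrite -mulgA (idemC (idem_mulss s) ee) mulgA ee.
Qed.
End NaturalOrder.

(** * Symmetry of isomorphism over a space *)

Section IsoSym.
Variable X : topologicalType.

Lemma cis_iso_sym (S T : complete_inverse_semigroup_over X) :
  cis_iso S T -> cis_iso T S.
Proof.
move=> [phi [[psi phiK psiK] phi_rep]].
have psiM : {morph psi : s t / s * t}.
  by move=> s t; apply: (can_inj phiK); rewrite gmulfM !psiK.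
pose mx := isMultiplicative.Build T S psi psiM.
pose psi' : {multiplicative T -> S} := HB.pack psi mx.
exists psi'; split; first by exists phi.
by move=> t; rewrite -phi_rep /= psiK.
Qed.
End IsoSym.

(** * The germs of the bisections of an étale groupoid *)

Section GermsOfBisections.
Variables (X : topologicalType) (G : etale_groupoid X).
Implicit Types (g h : G) (A B : bisection G).
Local Notation BG := (bisections G).
Implicit Types (p q : germs BG).

Lemma gd_inj_nbhs g : exists U : set G, [/\ open U, U g & set_inj U (@gd X G)].
Proof. by have [U [[oU Ug inj _] _]] := gd_local_homeo g; exists U. Qed.

(** Both [gd] and [gr], which is [gd] after inversion, are injective near [g]. *)
Lemma bisection_at g : exists A, A g.
Proof.
have [U [oU Ug Uinj]] := gd_inj_nbhs g.
have [V [oV Vg Vinj]] := gd_inj_nbhs (ginv g).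
have oW : open (U `&` @ginv X G @^-1` V).
  by apply: openI => //; have := (continuousP _).1 (@ginv_cont X G) _ oV.
have Wd : set_inj (U `&` @ginv X G @^-1` V) (@gd X G).
  by move=> h k /set_mem[Uh _] /set_mem[Uk _]; apply: Uinj; exact: mem_set.
have Wr : set_inj (U `&` @ginv X G @^-1` V) (@gr X G).
  move=> h k /set_mem[_ Vh] /set_mem[_ Vk] hk.
  rewrite -(ginvK h) -(ginvK k); congr ginv.
  by apply: Vinj; rewrite ?gd_inv//; exact: mem_set.
by exists (Bisection oW Wd Wr).
Qed.

Lemma bis_sub_dI A (W : set G) : W `<=` A -> set_inj W (@gd X G).
Proof. by move=> WA g h /set_mem/WA Ag /set_mem/WA; exact: bis_dI. Qed.

Lemma bis_sub_rI A (W : set G) : W `<=` A -> set_inj W (@gr X G).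
Proof. by move=> WA g h /set_mem/WA Ag /set_mem/WA; exact: bis_rI. Qed.

Definition bis_sub A (W : set G) (oW : open W) (WA : W `<=` A) : bisection G :=
  Bisection oW (bis_sub_dI WA) (bis_sub_rI WA).

Lemma pdom_bis_rep A x : pdom (cis_rep BG A) x <-> exists2 g, A g & gd g = x.
Proof.
split=> [[y /bis_repE[g [Ag <- _]]]|[g Ag <-]]; first by exists g.
by exists (gr g); apply/bis_repE; exists g.
Qed.

Lemma germ_open_bis A p : germ_open (A : BG) p -> exists2 g, A g & gd g = germ_d p.
Proof. by move=> /germ_open_pdom/pdom_bis_rep. Qed.

(** Germs may be evaluated: bisections with the same germ at a point have the
same arrow there, because an idempotent bisection defined at that point
contains its unit, and restricting to it keeps the arrow. *)
Lemma germ_open_agree A B p g : germ_open (A : BG) p -> germ_open (B : BG) p ->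
  A g -> gd g = germ_d p -> B g.
Proof.
move=> Ap Bp Ag gp.
have [f [ff fAB fp]] : exists f : bisection G,
    [/\ idem f, f * A = f * B & pdom (cis_rep BG f) (germ_d p)].
  exact: germ_openU Ap Bp.
have [u fu up] := (pdom_bis_rep _ _).1 fp.
have uE : u = gunit G (gd g) by rewrite (bis_idemE ff fu) up gp.
have : (f * A)%g g.
  by apply/bisM; exists u, g; split=> //; rewrite uE; exact: gcomp_ul.
rewrite fAB => /bisM[v [b [fv Bb c]]].
move: c; rewrite (bis_idemE ff fv) => c.
have := gcomp_c c; rewrite gr_unit => vb.
by rewrite (gcomp_fun c (gcomp_ul (esym vb))).
Qed.

(** Germs are separated by evaluation: the intersection [W] of [A] and [B] is a
bisection through [g], and [A] and [B] both restrict to [W] along the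
idempotent [W * star W], which is defined at the domain of [g]. *)
Lemma germ_open_of_common A B p g : germ_open (A : BG) p -> A g -> B g ->
  gd g = germ_d p -> germ_open (B : BG) p.
Proof.
move=> Ap Ag Bg gp.
pose W := bis_sub (openI (@bis_open _ _ A) (@bis_open _ _ B)) (@subIsetl _ A B).
have WA : nat_le W A by apply/bis_leE => h [].
have WB : nat_le W B by apply/bis_leE => h [].
apply: (@germ_open_eq _ BG A B (W * star W)) Ap.
- exact: idem_mulss.
- by rewrite (nat_leE WA) (nat_leE WB).
- apply/pdom_bis_rep; exists (gunit G (gd g)); last by rewrite gd_unit.
  apply/bisM; exists g, (ginv g); split; [by split| |exact: gcomp_ir].
  by apply/bis_starE; rewrite ginvK.
Qed.

Definition germ_eval p : G := s2val (cid2 (germ_open_bis (germ_repP p))).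

Lemma gd_germ_eval p : gd (germ_eval p) = germ_d p.
Proof. exact: s2valP' (cid2 (germ_open_bis (germ_repP p))). Qed.

(** The basic open sets of the groupoid of germs are the preimages of the
bisections; the comparison of both the points and the topologies follows from
this. *)
Lemma germ_evalP A p : germ_open (A : BG) p <-> A (germ_eval p).
Proof.
have rp := germ_repP p; have dp := gd_germ_eval p.
have Rp : (germ_rep p : bisection G) (germ_eval p).
  exact: s2valP (cid2 (germ_open_bis (germ_repP p))).
split=> [Ap|Ap]; first exact: germ_open_agree rp Ap Rp dp.
exact: germ_open_of_common rp Rp Ap dp.
Qed.

(** Any representative computes the evaluation; this is what identifies the
groupoid operations below. *)
Lemma germ_eval_eq A p g : germ_open (A : BG) p -> A g -> gd g = germ_d p ->
  germ_eval p = g.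
Proof.
by move=> /germ_evalP Ap Ag gp; apply: (bis_dI Ap Ag); rewrite gd_germ_eval.
Qed.

Lemma germ_eval_ex g : exists p, germ_eval p = g.
Proof.
have [A Ag] := bisection_at g.
have Adg : pdom (cis_rep BG A) (gd g) by apply/pdom_bis_rep; exists g.
by exists (mkgerm Adg); apply: germ_eval_eq (germ_open_mk _) Ag _.
Qed.

Lemma germ_eval_inj : injective germ_eval.
Proof.
move=> p q pq; apply: (germ_open_ext (germ_repP p)).
  by apply/germ_evalP; rewrite -pq; apply/germ_evalP; exact: germ_repP.
by rewrite -[LHS]/(germ_d p) -gd_germ_eval pq gd_germ_eval.
Qed.

Definition germ_at g : germs BG := projT1 (cid (germ_eval_ex g)).

Lemma germ_atK : cancel germ_at germ_eval.
Proof. by move=> g; rewrite /germ_at; case: cid. Qed.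

Lemma germ_evalK : cancel germ_eval germ_at.
Proof. exact: inj_can_sym germ_atK germ_eval_inj. Qed.

Lemma germ_eval_cont : continuous germ_eval.
Proof.
apply/continuousP => N oN; apply/open_germsP => p Np.
have Ap := (germ_evalP _ _).1 (germ_repP p).
pose W := bis_sub (openI (@bis_open _ _ (germ_rep p)) oN) (@subIsetl _ _ N).
exists (W : BG); first exact/germ_evalP.
by move=> q /germ_evalP[].
Qed.

Lemma germ_at_cont : continuous germ_at.
Proof.
apply/continuousP => U /open_germsP oU; rewrite openE => g /oU[A gA AU].
rewrite /interior nbhsE; exists A.
  by split; [exact: bis_open|rewrite -(germ_atK g); apply/germ_evalP].
by move=> h Ah; apply: AU; apply/germ_evalP; rewrite germ_atK.
Qed.

Lemma gr_germ_eval p : gr (germ_eval p) = germ_r p.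
Proof.
have Ap := germ_repP p; have := germ_rP Ap => /bis_repE[g [Ag gp <-]].
by rewrite (germ_eval_eq Ap Ag gp).
Qed.

Lemma germ_eval_unit x : germ_eval (germ_unit BG x) = gunit G x.
Proof.
have ee : idem (cis_unit BG) by exact: cis_mul1.
have /germ_evalP/(bis_idemE ee) -> := germ_unitP BG x.
by rewrite gd_germ_eval.
Qed.

Lemma germ_eval_inv p : germ_eval (germ_inv p) = ginv (germ_eval p).
Proof.
have Ap := germ_repP p; apply: (germ_eval_eq (germ_invP Ap)).
  by apply/bis_starE; rewrite ginvK; apply/germ_evalP.
by rewrite gd_inv gr_germ_eval.
Qed.

Lemma germ_eval_mul p q (pq : germ_r p = germ_d q)
    (pq' : gr (germ_eval p) = gd (germ_eval q)) :
  germ_eval (germ_mul pq) = gmul pq'.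
Proof.
have Ap := germ_repP p; have Bq := germ_repP q.
apply: (germ_eval_eq (germ_mulP pq Ap Bq)); last by rewrite gd_mul gd_germ_eval.
apply/bisM; exists (germ_eval p), (germ_eval q).
by split; [exact/germ_evalP|exact/germ_evalP|exists pq'].
Qed.

Lemma Germs_bisections : groupoid_iso (Germs BG) G.
Proof.
exists germ_eval, germ_at; split; split.
- exact: germ_evalK.
- exact: germ_atK.
- exact: germ_eval_cont.
- exact: germ_at_cont.
- exact: gd_germ_eval.
- exact: gr_germ_eval.
- exact: germ_eval_unit.
- exact: germ_eval_inv.
- exact: germ_eval_mul.
Qed.
End GermsOfBisections.

(** * The bisections of a groupoid of germs *)

Section BisectionsOfGerms.
Variables (X : topologicalType) (S : complete_inverse_semigroup_over X).
Local Notation rho := (cis_rep S).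
Local Notation H := (Germs S).
Implicit Types (s t e f : S) (V : bisection H).

Lemma rep_idem_inj e f : idem e -> idem f ->
  pdom (rho e) = pdom (rho f) -> e = f.
Proof.
move=> ee ff ef; have [_ inj _] := cis_full S.
by apply: inj; [exact: mem_set|exact: mem_set|apply: idem_ext => //; exact: rep_idem].
Qed.

Lemma pdom_mulss s : pdom (rho (s * star s)) = pdom (rho s).
Proof.
apply/seteqP; split=> x [y]; first by move=> /rep_mulE[z sx _]; exists z.
by move=> sx; exists x; apply/rep_mulE; exists y => //; apply/rep_starE.
Qed.

Lemma pdom_le s t : nat_le s t -> pdom (rho s) `<=` pdom (rho t).
Proof. by move=> [f ff ->] x /(pdom_idemM _ _ ff)[]. Qed.

(** Germs determine the order. Each idempotent [f] with [f * s = f * t] is cut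
down to [f * (s * star s)], so that the join [j] of all of these has exactly the
domain of [s * star s], and hence equals it by fullness. As each of them lies
below [t * star s], so does [s * star s], and multiplying by [s] on the right
gives [s] as a restriction of [t]. *)
Lemma germ_open_sub_le s t : germ_open s `<=` germ_open t -> nat_le s t.
Proof.
move=> st; pose A := [set f | idem f /\ f * s = f * t].
pose B := [set f * (s * star s) | f in A].
have Bi : B `<=` @idem S.
  by move=> _ [f [ff _] <-]; apply: idemM => //; exact: idem_mulss.
have [|j jB] := @cis_complete _ S B.
  by move=> e f /Bi ee /Bi ff; rewrite /compatible !idem_star//; split; exact: idemM.
have jj := idem_join Bi jB; have [ub lub] := jB.
have jE : j = s * star s.
  apply: rep_idem_inj => //; first exact: idem_mulss.
  apply/seteqP; split.
    apply: pdom_le; apply: lub => _ [f [ff _] <-].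
    by exists f.
  rewrite pdom_mulss => x sx.
  have [f [ff fst fx]] := germ_openU (germ_open_mk sx) (st _ (germ_open_mk sx)).
  apply: (pdom_le (ub _ _)); first by exists f.
  by apply/(pdom_idemM _ _ ff); split=> //; rewrite pdom_mulss.
have le : nat_le (s * star s) (t * star s).
  rewrite -jE; apply: lub => _ [f [ff fst] <-]; exists f => //.
  by rewrite !mulgA fst.
have := nat_leE le; rewrite (idem_star (idem_mulss s)) (idem_mulss s) => E.
have -> : s = s * star s * (t * (star s * s)).
  by rewrite -{1}(starKl s) -{1}E !mulgA.
have [c cc ->] := nat_le_mulr t (idem_starss s).
by exists (s * star s * c); [apply: idemM => //; exact: idem_mulss|rewrite mulgA].
Qed.

Lemma germ_open_dI s : set_inj (germ_open s) (@gd X H).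
Proof. by move=> g h /set_mem sg /set_mem; exact: germ_open_ext. Qed.

Lemma germ_open_rI s : set_inj (germ_open s) (@gr X H).
Proof.
move=> g h /set_mem sg /set_mem sh gh; apply: (germ_open_ext sg sh).
apply: (phomeo_inj (germ_rP sg)).
by rewrite (germ_rP sh); congr Some.
Qed.

Definition germ_bis s : bisection H :=
  @Bisection X H (germ_open s) (open_germ_open s) (@germ_open_dI s) (@germ_open_rI s).

Lemma germ_bisM : {morph germ_bis : s t / s * t}.
Proof.
move=> s t; apply: bis_ext => k; split.
  move=> stk; have [y /rep_mulE[z sz tz]] := germ_open_pdom stk.
  have sx : pdom (rho s) (germ_pt k) by exists z.
  have tx : pdom (rho t) z by exists y.
  have c : germ_r (mkgerm sx) = germ_d (mkgerm tx) by exact: germ_rE.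
  apply/bisM; exists (mkgerm sx), (mkgerm tx); split; try exact: germ_open_mk.
  exists c; apply: germ_open_ext stk _; last by [].
  by apply: germ_mulP; exact: germ_open_mk.
by move=> /bisM[g [h [sg th [c <-]]]]; exact: germ_mulP.
Qed.

HB.instance Definition _ :=
  isMultiplicative.Build S (bisection H) germ_bis germ_bisM.

Lemma germ_bis_inj : injective germ_bis.
Proof.
move=> s t st; apply: nat_le_anti; apply: germ_open_sub_le => g.
  by rewrite -[germ_open s g]/(germ_bis s g) st.
by rewrite -[germ_open t g]/(germ_bis t g) -st.
Qed.

Lemma germ_bis_star s : germ_bis (star s) = star (germ_bis s).
Proof.
by apply: star_unique; rewrite /is_inverse -!germ_bisM starKl starKr.
Qed.

Lemma idem_germ_bis s : idem (germ_bis s) -> idem s.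
Proof. by rewrite /idem /= -germ_bisM => /germ_bis_inj. Qed.

Lemma compatible_germ_bis s t :
  compatible (germ_bis s) (germ_bis t) -> compatible s t.
Proof.
by rewrite /compatible -!germ_bis_star -!germ_bisM => -[? ?]; split;
  exact: idem_germ_bis.
Qed.

Lemma germ_bis_le s t : nat_le s t -> nat_le (germ_bis s) (germ_bis t).
Proof.
move=> [f ff ->]; exists (germ_bis f); last exact: germ_bisM.
by rewrite /idem /= -germ_bisM ff.
Qed.

(** The union of the domains is open, so fullness gives an idempotent [f] with
that domain; [f * s] is still an upper bound, and the domain of [s] cannot exceed
that of [f]. *)
Lemma pdom_join (A : set S) s : is_join A s ->
  pdom (rho s) `<=` \bigcup_(t in A) pdom (rho t).
Proof.
move=> [ub lub].
have oU : open (\bigcup_(t in A) pdom (rho t)).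
  by apply: bigcup_open => t _; exact: open_pdom.
have [f ff fU] := idem_of_open S oU.
suff /pdom_le le : nat_le s (f * s).
  by move=> x /le /(pdom_idemM _ _ ff)[]; rewrite fU.
apply: lub => t At; exists (t * star t); first exact: idem_mulss.
have ft : t * star t * f = t * star t.
  apply: rep_idem_inj; [by apply: idemM => //; exact: idem_mulss|exact: idem_mulss|].
  apply/seteqP; split=> x.
    by move=> /(pdom_idemM _ _ (idem_mulss t))[].
  move=> tx; apply/(pdom_idemM _ _ (idem_mulss t)); split=> //.
  by rewrite fU; exists t => //; rewrite -pdom_mulss.
by rewrite mulgA ft (nat_leE (ub _ At)).
Qed.

(** The [s] whose germs all lie in [V] have a common upper bound after applying
[germ_bis]; this makes their images compatible, and compatibility is reflected
because [germ_bis] is injective and multiplicative. *)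
Lemma germ_bis_surj V : exists s, germ_bis s = V.
Proof.
pose A := [set s | nat_le (germ_bis s) V].
have [|j jA] := @cis_complete _ S A.
  move=> s t As At; apply: compatible_germ_bis; exact: nat_le_compatible As At.
(* [germ_bis j] contains the basic open sets that cover [V]; conversely, a germ
   of [j] has its base point in the domain of some [s] in [A], and there it is
   the germ of [s], as [germ_bis s] is contained in [germ_bis j]. *)
exists j; apply: bis_ext => g; split.
  move=> jg; have [s As sg] := pdom_join jA (germ_open_pdom jg).
  have /bis_leE sj := germ_bis_le (jA.1 _ As).
  have -> : g = mkgerm sg.
    by apply: (germ_open_ext jg) => //; apply: sj; exact: germ_open_mk.
  by move/bis_leE: As; apply; exact: germ_open_mk.
move=> Vg; have [s sg sV] := (open_germsP _).1 (@bis_open _ _ V) g Vg.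
have As : A s by apply/bis_leE.
by have /bis_leE := germ_bis_le (jA.1 _ As); apply.
Qed.

Lemma bis_rep_germ_bis s : cis_rep (bisections H) (germ_bis s) = rho s.
Proof.
apply: phomeo_ext => x y; split.
  by move=> /bis_repE[g [sg <- <-]]; exact: germ_rP.
move=> sxy; have sx : pdom (rho s) x by exists y.
apply/bis_repE; exists (mkgerm sx); split=> //; first exact: germ_open_mk.
exact: germ_rE.
Qed.

Lemma bisections_Germs : cis_iso (bisections H) S.
Proof.
apply: cis_iso_sym; exists germ_bis; split; last exact: bis_rep_germ_bis.
have germ_invK V : germ_bis (projT1 (cid (germ_bis_surj V))) = V by case: cid.
by exists (fun V => projT1 (cid (germ_bis_surj V))) => // s; exact: germ_bis_inj.
Qed.
End BisectionsOfGerms.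

Theorem corollary5p4 (X : topologicalType) :
  (forall G : etale_groupoid X, groupoid_iso (Germs (bisections G)) G) /\
  (forall S : complete_inverse_semigroup_over X,
     cis_iso (bisections (Germs S)) S).
Proof.
by split=> [G|S]; [exact: Germs_bisections|exact: bisections_Germs].
Qed.
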